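(* Let $p \neq 2$ be a prime. Let $|C_1|$ denote the number of collisions $(h,a)$, i.e. the number of pairs $(h,a)$ with $h, a \in \{1, 2, \ldots, p(p-1)\}$, $p \nmid h$, $p \nmid a$, and $h^h \equiv a^a \pmod{p}$. Then $$|C_1| = \sum_{0 \le x_0, y_0 \le p-2} (p-1)\gcd(x_0, y_0, p-1) = (p-1) \sum_{d \mid p-1} d\, J_2\left(\frac{p-1}{d}\right).$$
   Context: $J_2(n) = n^2 \prod_{q \mid n} (1 - q^{-2})$ (product over the primes $q$ dividing $n$) is Jordan's totient function, which counts the number of pairs of positive integers all less than or equal to $n$ that form a mutually coprime triple together with $n$ (i.e. the greatest common divisor of the three numbers is $1$). Here $\gcd(0,n)=n$, so $\gcd(0,0,p-1) = p-1$. *)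

(* Defs.v *)
From mathcomp Require Import all_boot all_order all_algebra.

Set Implicit Arguments.
Unset Strict Implicit.
Unset Printing Implicit Defensive.

Import GRing.Theory.

(* Jordan's totient J_2, by its Euler product; the factors 1 - q^-2 are not
   integers, so the value is taken in rat. *)
Definition jordan2 (n : nat) : rat :=
  (n%:R ^+ 2 * \prod_(q <- primes n) (1 - q%:R ^- 2))%R.

(* Ordered pairs (h, a), the trivial collisions h = a included.  The ordinals
   range over 0, ..., p(p-1); the value 0 is removed by 1 <= h and 1 <= a. *)
Definition collisions (p : nat)
    : {set 'I_(p * (p - 1)).+1 * 'I_(p * (p - 1)).+1} :=
  [set ha : 'I_(p * (p - 1)).+1 * 'I_(p * (p - 1)).+1 |
    [&& 1 <= ha.1, 1 <= ha.2, ~~ (p %| ha.1), ~~ (p %| ha.2)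
      & ha.1 ^ ha.1 == ha.2 ^ ha.2 %[mod p]]].

(* Main.v *)
Require Import Defs.
From mathcomp Require Import all_boot all_order all_algebra.
From mathcomp Require Import all_fingroup all_solvable.

Set Implicit Arguments.
Unset Strict Implicit.
Unset Printing Implicit Defensive.

Import GRing.Theory.

(** Write n = p - 1.  A number h in 1, ..., pn that is prime to p is determined,
    by the Chinese remainder theorem, by its residue x mod n together with its
    class u in the units of F_p, and both can be prescribed freely.  By Fermat
    h ^ h = u ^ x in F_p, so base and exponent have become independent, and a
    collision is a quadruple (x, u, y, v) with u ^ x = v ^ y
    ([self_power_mod]).  For fixed x and y the solutions (u, v) form the kernel
    of the homomorphism (u, v) |-> u ^ x v ^ -y on the square of a cyclic group
    of order n.  If g is a generator, the image is generated by
    g ^ gcd(x, y), hence has order n / gcd(x, y, n), and the kernel has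
    n gcd(x, y, n) elements ([card_cyclic_pow_eq]).  Summing over x and y gives
    the first equality.

    For the second equality, group the pairs (x, y) by d = gcd(x, y, n).  Those
    with a given d are d times the pairs below n / d that are coprime together
    with n / d ([sum_gcd_eq]).  That these are counted by the Euler product
    J_2(n / d) is proved by sieving the primes out one at a time: among the
    pairs below n that survive earlier primes, those with both coordinates
    divisible by q are q times the surviving pairs below n / q, so each
    new prime multiplies the count by 1 - q ^ -2 ([sum_unsieved]). *)

(** * Pairs of equal powers in a cyclic group *)

(** The solutions form the kernel of (a, b) |-> a ^ x b ^ -y, whose image is
    generated by g ^ gcd(x, y) for any generator g; the count is the index
    formula. *)
Lemma card_cyclic_pow_eq (gT : finGroupType) (G : {group gT}) (x y : nat) :
  cyclic G ->
  #|[set ab in setX G G | ab.1 ^+ x == ab.2 ^+ y]%g| =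
    #|G| * gcdn (gcdn x y) #|G|.
Proof.
move=> cG; have abG := cyclic_abelian cG; case/cyclicP: cG => g defG.
have gG : g \in G by rewrite defG cycle_id.
pose f (ab : gT * gT) : gT := (ab.1 ^+ x * ab.2 ^- y)%g.
have fM : {in setX G G &, {morph f : u v / (u * v)%g}}.
  move=> [a b] [c d]; rewrite !in_setX /= => /andP[aG bG] /andP[cG dG].
  have com u v : u \in G -> v \in G -> commute u v.
    by move=> uG vG; exact: (centsP abG).
  rewrite /f /= expgMn; last exact: com.
  rewrite expgMn; last exact: com.
  rewrite invMg -!mulgA; congr (_ * _)%g.
  by rewrite mulgA; apply: com; rewrite ?groupM ?groupV ?groupX.
pose phi := Morphism fM.
have kerE : ('ker phi)%g = [set ab in setX G G | ab.1 ^+ x == ab.2 ^+ y]%g.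
  apply/setP=> ab; rewrite inE [RHS]inE; congr (_ && _).
  by rewrite !inE -eq_mulgV1.
have imE : (phi @* setX G G)%g = <[g ^+ gcdn x y]>%g.
  apply/eqP; rewrite eqEsubset; apply/andP; split; last first.
    rewrite cycle_subG; case: (posnP x) => [x0|x_gt0].
      rewrite x0 gcd0n; apply/morphimP.
      exists (1, g^-1)%g; rewrite ?in_setX ?groupV ?group1 //.
      by rewrite /= /f /= x0 expgVn invgK expg0 mul1g.
    (* Bezout: u x = v y + gcd(x, y), so (g ^ u, g ^ v) maps to g ^ gcd(x, y). *)
    case: (egcdnP y x_gt0) => u v uxE _.
    apply/morphimP; exists (g ^+ u, g ^+ v)%g;
      rewrite ?in_setX ?groupX //= /f /=.
    by rewrite -!expgM uxE addnC expgD mulgK.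
  have mem_dvd k z : gcdn x y %| z -> (g ^+ (k * z) \in <[g ^+ gcdn x y]>)%g.
    by case/dvdnP=> m ->; rewrite mulnA mulnC expgM mem_cycle.
  apply/subsetP=> _ /morphimP[[a b] _ + ->]; rewrite in_setX /= defG.
  case/andP=> /cycleP[i ->] /cycleP[j ->]; rewrite /f /= -!expgM.
  by rewrite groupM ?groupV ?mem_dvd ?dvdn_gcdl ?dvdn_gcdr.
rewrite -kerE; have := LagrangeI (setX G G) ('ker phi)%G.
have -> : (setX G G :&: 'ker phi)%g = ('ker phi)%g.
  by apply/setIidPr; exact: subsetIl.
have := card_morphim phi (setX G G); rewrite setIid imE => <-.
rewrite -orderE orderXgcd orderE -defG cardsX gcdnC => eqc.
have d_dvd : gcdn (gcdn x y) #|G| %| #|G| := dvdn_gcdr _ _.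
have q_gt0 : 0 < #|G| %/ gcdn (gcdn x y) #|G|.
  by rewrite divn_gt0 ?gcdn_gt0 ?cardG_gt0 ?orbT // dvdn_leq ?cardG_gt0.
apply/eqP; rewrite -(eqn_pmul2r q_gt0) eqc -mulnA; apply/eqP.
by congr (_ * _); rewrite mulnC divnK.
Qed.

(** * Jordan's totient counts coprime triples *)

Lemma sum_dvdn_scale (q m : nat) (F : nat -> nat) : 0 < q ->
  \sum_(0 <= x < q * m | q %| x) F x = \sum_(0 <= x < m) F (q * x).
Proof.
move=> q_gt0; elim: m => [|m IHm]; first by rewrite muln0 !big_geq.
rewrite mulnSr (@big_cat_nat _ _ _ (q * m)) ?leq_addr //= IHm big_nat_recr //=.
congr (_ + _); rewrite big_ltn_cond ?dvdn_mulr //;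
  last by rewrite -ltn_subLR ?subnn.
rewrite big_nat_cond big1 ?addn0 // => x /andP[/andP[ltx xlt] q_x].
have: q %| x - q * m by rewrite dvdn_sub ?dvdn_mulr.
by rewrite gtnNdvd ?subn_gt0 // ltn_subLR // ltnW.
Qed.

Lemma sum_dvdn_scale2 (q m : nat) (F : nat -> nat -> nat) : 0 < q ->
  \sum_(0 <= x < q * m) \sum_(0 <= y < q * m | (q %| x) && (q %| y)) F x y =
    \sum_(0 <= x < m) \sum_(0 <= y < m) F (q * x) (q * y).
Proof.
move=> q_gt0.
rewrite -(sum_dvdn_scale m (fun x => \sum_(0 <= y < m) F x (q * y))) //.
rewrite [RHS]big_mkcond.
apply: eq_bigr => x _; case: ifP => qx /=.
  by rewrite -sum_dvdn_scale.
by rewrite big_pred0_eq.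
Qed.

(** For s the primes dividing n, this is coprimality of the triple (x, y, n);
    an arbitrary s allows the primes to be removed one by one while n varies. *)
Definition unsieved (s : seq nat) (x y : nat) : bool :=
  all (fun q => ~~ ((q %| x) && (q %| y))) s.

(** Sieve of Eratosthenes on pairs.  The induction on [s] must be uniform in
    [n], since the pairs removed by the prime [q] are the [s]-unsieved pairs
    below [n / q], scaled by [q]; scaling by [q] does not affect divisibility by
    the other primes. *)
Lemma sum_unsieved (s : seq nat) (n : nat) :
  0 < n -> uniq s -> {in s, forall q, prime q && (q %| n)} ->
  ((\sum_(0 <= x < n) \sum_(0 <= y < n) unsieved s x y)%:R =
    n%:R ^+ 2 * \prod_(q <- s) (1 - q%:R ^- 2) :> rat)%R.
Proof.
elim: s n => [|q s IHs] n n_gt0 /=.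
  move=> _ _; rewrite big_nil mulr1 -natrX; congr (_%:R)%R.
  by rewrite !big_const_nat !subn0 !iter_addn_0 mul1n.
case/andP=> qs uniq_s pr_s.
have /andP[q_pr q_n] : prime q && (q %| n) by apply: pr_s; rewrite mem_head.
have q_gt0 := prime_gt0 q_pr.
set m := n %/ q; have def_n : n = q * m by rewrite mulnC divnK.
have m_gt0 : 0 < m by move: n_gt0; rewrite def_n muln_gt0 => /andP[].
have s_n : {in s, forall r, prime r && (r %| n)}.
  by move=> r rs; apply: pr_s; rewrite in_cons rs orbT.
have s_q r : r \in s -> forall x, (r %| q * x) = (r %| x).
  move=> rs x; have /andP[r_pr _] := s_n r rs.
  rewrite Euclid_dvdM // dvdn_prime2 //.
  by case: eqP => // rq; move: qs; rewrite -rq rs.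
have s_m : {in s, forall r, prime r && (r %| m)}.
  by move=> r rs; have:= s_n r rs; rewrite def_n s_q.
have split_q : \sum_(0 <= x < n) \sum_(0 <= y < n) unsieved (q :: s) x y
    + \sum_(0 <= x < m) \sum_(0 <= y < m) unsieved s x y
    = \sum_(0 <= x < n) \sum_(0 <= y < n) unsieved s x y.
  have -> : \sum_(0 <= x < m) \sum_(0 <= y < m) unsieved s x y =
      \sum_(0 <= x < n) \sum_(0 <= y < n | (q %| x) && (q %| y)) unsieved s x y.
    rewrite def_n sum_dvdn_scale2 //.
    apply: eq_bigr => x _; apply: eq_bigr => y _; congr nat_of_bool.
    by apply: eq_in_all => r rs; rewrite !s_q.
  rewrite -big_split; apply: eq_bigr => x _ /=.
  rewrite [X in _ + X]big_mkcond -big_split; apply: eq_bigr => y _ /=.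
  by rewrite {1}/unsieved /=; case: ((q %| x) && (q %| y)); rewrite ?addn0.
have /(congr1 (fun k => k%:R%R : rat)) := split_q.
rewrite /= natrD (IHs n) // (IHs m) // => /eqP.
rewrite eq_sym -subr_eq => /eqP <-.
have q_neq0 : (q%:R != 0 :> rat)%R by rewrite Num.Theory.pnatr_eq0 -lt0n.
rewrite big_cons def_n natrM exprMn mulrA -mulrBl; congr (_ * _)%R.
rewrite mulrBr mulr1; congr (_ - _)%R.
by rewrite mulrAC divff ?mul1r // expf_neq0.
Qed.

Lemma coprime_unsieved (n x y : nat) : 0 < n ->
  (gcdn (gcdn x y) n == 1) = unsieved (primes n) x y.
Proof.
move=> n_gt0; apply/eqP/allP => [g1 q|uns].
  rewrite mem_primes => /and3P[q_pr _ q_n]; apply/negP; rewrite -dvdn_gcd => q_xy.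
  have: q %| gcdn (gcdn x y) n by rewrite dvdn_gcd q_xy.
  by rewrite g1 dvdn1 => /eqP q1; rewrite q1 in q_pr.
apply/eqP; apply: contraT => g_neq1.
have g_gt1 : 1 < gcdn (gcdn x y) n.
  by rewrite ltn_neqAle eq_sym g_neq1 gcdn_gt0 n_gt0 orbT.
have := pdiv_dvd (gcdn (gcdn x y) n); rewrite !dvdn_gcd => /andP[d_xy d_n].
have /uns : pdiv (gcdn (gcdn x y) n) \in primes n.
  by rewrite mem_primes pdiv_prime ?n_gt0.
by rewrite d_xy.
Qed.

Lemma jordan2E (n : nat) : 0 < n ->
  jordan2 n =
    (\sum_(0 <= x < n) \sum_(0 <= y < n) (gcdn (gcdn x y) n == 1))%:R%R.
Proof.
move=> n_gt0; rewrite /jordan2 -sum_unsieved ?primes_uniq //.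
  congr (_%:R)%R; apply: eq_bigr => x _; apply: eq_bigr => y _.
  by rewrite coprime_unsieved.
by move=> q; rewrite mem_primes n_gt0.
Qed.

(** Division by [d] is a bijection from the pairs with gcd(x, y, n) = d onto the
    coprime pairs below [n / d]. *)
Lemma sum_gcd_eq (n d : nat) : 0 < n -> d %| n ->
  \sum_(0 <= x < n) \sum_(0 <= y < n) (gcdn (gcdn x y) n == d) =
  \sum_(0 <= x < n %/ d) \sum_(0 <= y < n %/ d)
    (gcdn (gcdn x y) (n %/ d) == 1).
Proof.
move=> n_gt0 d_n; have d_gt0 := dvdn_gt0 n_gt0 d_n.
set m := n %/ d; have def_n : n = d * m by rewrite mulnC divnK.
transitivity (\sum_(0 <= x < n) \sum_(0 <= y < n | (d %| x) && (d %| y))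
    (gcdn (gcdn x y) n == d)).
  apply: eq_bigr => x _; rewrite [RHS]big_mkcond; apply: eq_bigr => y _ /=.
  case: ifPn => //; rewrite -dvdn_gcd => dNxy.
  by case: eqP => // gE; case/negP: dNxy; rewrite -{1}gE dvdn_gcdl.
rewrite def_n sum_dvdn_scale2 //.
apply: eq_bigr => x _; apply: eq_bigr => y _; congr nat_of_bool.
by rewrite -!muln_gcdr -{2}[d]muln1 eqn_pmul2l.
Qed.

Lemma sum_gcd_jordan2 (n : nat) : 0 < n ->
  ((\sum_(0 <= x < n) \sum_(0 <= y < n) gcdn (gcdn x y) n)%:R =
    \sum_(d <- divisors n) d%:R * jordan2 (n %/ d) :> rat)%R.
Proof.
move=> n_gt0.
have -> : (\sum_(0 <= x < n) \sum_(0 <= y < n) gcdn (gcdn x y) n =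
    \sum_(d <- divisors n)
      d * \sum_(0 <= x < n) \sum_(0 <= y < n) (gcdn (gcdn x y) n == d))%N.
  transitivity (\sum_(0 <= x < n) \sum_(d <- divisors n) \sum_(0 <= y < n)
      d * (gcdn (gcdn x y) n == d)).
    apply: eq_bigr => x _; rewrite [RHS]exchange_big; apply: eq_bigr => y _ /=.
    rewrite (bigD1_seq (gcdn (gcdn x y) n)) ?divisors_uniq //=; last first.
      by rewrite -dvdn_divisors // dvdn_gcdr.
    rewrite eqxx muln1 big1 ?addn0 // => d.
    by rewrite eq_sym => /negbTE->; rewrite muln0.
  rewrite exchange_big; apply: eq_bigr => d _.
  by rewrite big_distrr; apply: eq_bigr => x _; rewrite big_distrr.
rewrite natr_sum [LHS]big_seq [RHS]big_seq; apply: eq_bigr => d.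
rewrite -dvdn_divisors // => d_n; rewrite natrM sum_gcd_eq // -jordan2E //.
by rewrite divn_gt0 ?(dvdn_gt0 n_gt0) // dvdn_leq.
Qed.

(** * Chinese remainder parametrization of the collisions *)

Section Collisions.

Variable p : nat.
Hypothesis p_pr : prime p.

Let n := p - 1.
Let U := {unit 'F_p}.

Lemma card_unit_Fp : #|[set: U]| = n.
Proof. by rewrite card_finField_unit card_Fp // /n subn1. Qed.

Lemma pred_prime_gt0 : 0 < n.
Proof. by rewrite /n subn_gt0 prime_gt1. Qed.

Lemma coprime_pred : coprime p n.
Proof. by rewrite /n subn1 coprime_sym coprimePn ?prime_gt0. Qed.

Definition crt_pair (xu : 'I_n * U) : 'I_(p * n).+1 :=
  inord (chinese p n (val xu.2) xu.1 %% (p * n)).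

Lemma crt_pair_val xu :
  crt_pair xu = chinese p n (val xu.2) xu.1 %% (p * n) :> nat.
Proof.
by rewrite inordK // ltnS ltnW // ltn_pmod // muln_gt0 prime_gt0 ?pred_prime_gt0.
Qed.

Lemma crt_pair_modn xu : crt_pair xu %% n = xu.1.
Proof.
rewrite crt_pair_val modn_dvdm ?dvdn_mull //.
by rewrite chinese_modr ?coprime_pred // modn_small.
Qed.

Lemma crt_pair_Fp xu : (crt_pair xu)%:R%R = val xu.2 :> 'F_p.
Proof.
apply/val_inj; rewrite /= val_Fp_nat // crt_pair_val modn_dvdm ?dvdn_mulr //.
rewrite chinese_modl ?coprime_pred // modn_small //.
by rewrite -[X in _ < X](Fp_cast p_pr).
Qed.

Lemma crt_pair_inj : injective crt_pair.
Proof.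
move=> [x u] [y v] eq_c; have := crt_pair_modn (x, u); have:= crt_pair_Fp (x, u).
rewrite eq_c crt_pair_modn crt_pair_Fp /= => /val_inj -> /val_inj -> //.
Qed.

Lemma crt_pair_dvd xu : ~~ (p %| crt_pair xu).
Proof.
rewrite -prime_coprime // -unitFpE // crt_pair_Fp; exact: (valP xu.2).
Qed.

(** The values h = 0 and h = pn, both congruent to 0, are multiples of p, so a
    full set of residues mod pn is all that remains. *)
Lemma crt_pair_onto (h : 'I_(p * n).+1) :
  ~~ (p %| h) -> exists xu, h = crt_pair xu.
Proof.
move=> pNh; have h_unit : (h%:R : 'F_p)%R \is a GRing.unit.
  by rewrite unitFpE // prime_coprime.
pose x : 'I_n := Ordinal (ltn_pmod h pred_prime_gt0).
exists (x, FinRing.unit 'F_p h_unit); apply/val_inj; rewrite /= crt_pair_val /=.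
rewrite val_Fp_nat // -(chinese_mod coprime_pred) modn_small //.
have := ltn_ord h; rewrite ltnS leq_eqVlt => /predU1P[hE|//].
by rewrite hE dvdn_mulr in pNh.
Qed.

(** The order of a unit divides n = p - 1, so the exponent h matters only through
    its residue x mod n, which is independent of the class of h mod p. *)
Lemma self_power_mod (xu yv : 'I_n * U) :
  (crt_pair xu ^ crt_pair xu == crt_pair yv ^ crt_pair yv %[mod p]) =
  (xu.2 ^+ xu.1 == yv.2 ^+ yv.1)%g.
Proof.
have powE zw : ((crt_pair zw ^ crt_pair zw)%:R = val (zw.2 ^+ zw.1)%g :> 'F_p)%R.
  rewrite natrX crt_pair_Fp -FinRing.val_unitX; congr val.
  apply/eqP; rewrite eq_expg_mod_order -(crt_pair_modn zw) eq_sym.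
  have ord_n (u : U) : #[u]%g %| n by rewrite -card_unit_Fp order_dvdG ?inE.
  by rewrite modn_dvdm.
by rewrite -(inj_eq val_inj) -!powE -(inj_eq val_inj) /= !val_Fp_nat.
Qed.

Lemma card_collisions_gcd :
  #|collisions p| =
    \sum_(0 <= x0 < n) \sum_(0 <= y0 < n) n * gcdn (gcdn x0 y0) n.
Proof.
pose c2 (z : ('I_n * U) * ('I_n * U)) := (crt_pair z.1, crt_pair z.2).
have c2_inj : injective c2.
  by move=> [z w] [z' w'] [/crt_pair_inj-> /crt_pair_inj->].
have -> : collisions p =
    [set c2 z | z in
      [set z : ('I_n * U) * ('I_n * U) | z.1.2 ^+ z.1.1 == z.2.2 ^+ z.2.1]%g].
  apply/setP=> -[h a]; apply/idP/imsetP => [|[[z w]]].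
    rewrite inE => /= /and5P[_ _ /crt_pair_onto[z ->] /crt_pair_onto[w ->]].
    by rewrite self_power_mod => zw; exists (z, w); rewrite ?inE.
  rewrite !inE /= => zw [-> ->]; rewrite self_power_mod zw !crt_pair_dvd.
  have pos xu : 0 < crt_pair xu.
    by rewrite lt0n; apply: contraNneq (crt_pair_dvd xu) => ->; exact: dvdn0.
  by rewrite !pos.
have sum_pair (F : 'I_n * U -> nat) : \sum_z F z = \sum_x \sum_u F (x, u).
  by rewrite pair_bigA; apply: eq_bigr => -[].
rewrite card_imset //; transitivity
    (\sum_(z : 'I_n * U) \sum_(w : 'I_n * U) (z.2 ^+ z.1 == w.2 ^+ w.1)%g).
  rewrite pair_bigA -sum1_card big_mkcond /=.
  by apply: eq_bigr => z _; rewrite inE; case: ifP.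
rewrite sum_pair big_mkord; apply: eq_bigr => x _.
under eq_bigr => u _ do rewrite sum_pair.
rewrite exchange_big big_mkord; apply: eq_bigr => y _ /=.
move: (nat_of_ord x) (nat_of_ord y) => {}x {}y.
rewrite -card_unit_Fp -card_cyclic_pow_eq ?field_unit_group_cyclic //.
rewrite pair_bigA -sum1_card [RHS]big_mkcond /=.
by apply: eq_bigr => uv _; rewrite !inE /=; case: (_ == _).
Qed.

End Collisions.

Theorem corollary20 (p : nat) (p_prime : prime p) (p_neq2 : p <> 2) :
  #|collisions p| =
    \sum_(0 <= x0 < p - 1) \sum_(0 <= y0 < p - 1)
      (p - 1) * gcdn (gcdn x0 y0) (p - 1)
  /\
  ((\sum_(0 <= x0 < p - 1) \sum_(0 <= y0 < p - 1)
      (p - 1) * gcdn (gcdn x0 y0) (p - 1))%N%:R =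
    (p - 1)%N%:R *
      \sum_(d <- divisors (p - 1)) d%:R * jordan2 ((p - 1) %/ d) :> rat)%R.
Proof.
split; first exact: card_collisions_gcd.
rewrite -sum_gcd_jordan2 ?pred_prime_gt0 // -natrM; congr (_%:R)%R.
by rewrite big_distrr; apply: eq_bigr => x _; rewrite big_distrr.
Qed.
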